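(* Assume that all optimality cuts, i.e. $\mathrm{Cut}_p(\bar x,\bar y)$ for every $p\in\mathcal P$ and every first-stage feasible $(\bar x,\bar y)$ (there are finitely many distinct such cuts), have been added to RMP at iteration $k$. Then for a solution $(x^k,y^k,\mu^k)$ obtained by solving the resulting problem (an optimal solution) we have $$\mu^k_p=Q_p(x^k,y^k)\quad\text{for all } p\in\mathcal P.$$
   Context: Data. $\mathcal P$ (products) and $\mathcal F$ (facilities) are finite sets. Facility $f$ has capacity $B_f\ge 0$. For $p\in\mathcal P,f\in\mathcal F$, $\mathcal L_{pf}$ is a finite set of production levels; level $l$ has bounds $0\le L_{pfl}\le U_{pfl}$; the intervals $[L_{pfl},U_{pfl}]$, $l\in\mathcal L_{pf}$, are pairwise disjoint and some level has $L_{pfl}=U_{pfl}=0$. $C_{pf}$ is a unit cost, $P_p$ the full price, $O_p$ the discounted price, with $0\le O_p<P_p$ and $O_p<C_{pf}$ for all $f$. For each $p$, $\mathcal D_p$ is a finite set of distributions, and $l(p,f,d)\in\mathcal L_{pf}$ is the level at facility $f$ associated with $d\in\mathcal D_p$; for each $p$, every combination of levels $(l_f)_{f\in\mathcal F}$, $l_f\in\mathcal L_{pf}$, determines exactly one $d\in\mathcal D_p$ with $l(p,f,d)=l_f$ for all $f$. Each $d\in\mathcal D_p$ has a finite scenario set $\mathcal S_{pd}$ with probabilities $\pi_{sd}\ge 0$ summing to $1$; in scenario $s$ the yield at $f$ is $Y_{pfds}\ge 0$ and the demand is $D_{pds}\ge 0$. Variables: $x_{pf}\ge 0$, $y_{pfl}\in\{0,1\}$,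 $\mu_p$. First-stage constraints: $\sum_{p}x_{pf}\le B_f$ for all $f$; $\sum_{l\in\mathcal L_{pf}}y_{pfl}=1$ and $\sum_l L_{pfl}y_{pfl}\le x_{pf}\le\sum_l U_{pfl}y_{pfl}$ for all $p,f$. A pair $(x,y)$ satisfying these is first-stage feasible. For such $y$, $d_p(y)$ is the unique $d\in\mathcal D_p$ with $y_{p,f,l(p,f,d)}=1$ for all $f$. Expected revenue: with $d=d_p(y)$ and $z_{pds}=\sum_{f}Y_{pfds}x_{pf}$, $Q_p(x,y)=\sum_{s\in\mathcal S_{pd}}\pi_{sd}\,\max\{P_pw+O_po: w+o=z_{pds},\ w\le D_{pds},\ w,o\ge0\}$, where the maximum equals $P_p\min\{D_{pds},z_{pds}\}+O_p\max\{z_{pds}-D_{pds},0\}$. Bound: with $\bar Z_{pds}=\sum_f Y_{pfds}\min\{B_f,U_{p,f,l(p,f,d)}\}$, $M_p=\max_{d\in\mathcal D_p}\sum_{s\in\mathcal S_{pd}}\pi_{sd}\big(P_p\min\{D_{pds},\bar Z_{pds}\}+O_p\max\{\bar Z_{pds}-D_{pds},0\}\big)$. RMP (relaxed master problem): maximize $-\sum_{p}\sum_f C_{pf}x_{pf}+\sum_p\mu_p$ subject to the first-stage constraints and $0\le\mu_p\le M_p$ for all $p$. The Benders-based algorithm solves, at each iteration $k$, RMP together with the optimality cuts added so far, obtaining an optimal solution $(x^k,y^k,\mu^k)$; for each $p$ with $\mu^k_p>Q_p(x^k,y^k)$ it adds $\mathrm{Cut}_p(x^k,y^k)$. Scenario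 partition: for first-stage feasible $(\bar x,\bar y)$ and $d=d_p(\bar y)$, $\mathcal S^{\uparrow}_{pd}(\bar x,\bar y)=\{s\in\mathcal S_{pd}: D_{pds}<\sum_fY_{pfds}\bar x_{pf}\}$ and $\mathcal S^{\downarrow}_{pd}(\bar x,\bar y)=\mathcal S_{pd}\setminus\mathcal S^{\uparrow}_{pd}(\bar x,\bar y)$. Optimality cut $\mathrm{Cut}_p(\bar x,\bar y)$: the inequality in $(x,y,\mu)$, with $d=d_p(\bar y)$, $$\mu_p \le \sum_{s\in\mathcal S^{\downarrow}_{pd}(\bar x,\bar y)}\pi_{sd}\Big(P_p\sum_{f}Y_{pfds}x_{pf}\Big)+\sum_{s\in\mathcal S^{\uparrow}_{pd}(\bar x,\bar y)}\pi_{sd}\Big(O_p\sum_{f}Y_{pfds}x_{pf}+(P_p-O_p)D_{pds}\Big)+M_p\Big(|\mathcal F|-\sum_{f}y_{p,f,l(p,f,d)}\Big).$$ *)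

(* Defs.v *)
From HB Require Import structures.
From mathcomp Require Import all_boot all_order all_algebra.
From mathcomp Require Import all_classical all_reals.
From mathcomp Require Import lra.

Set Implicit Arguments.
Unset Strict Implicit.
Unset Printing Implicit Defensive.

Import Order.TTheory GRing.Theory Num.Theory.
Local Open Scope classical_set_scope.
Local Open Scope ring_scope.

(* The finite index sets are types: levels L_{pf}, distributions D_p and
   scenarios S_{pd} depend on the indices they are attached to, and
   [level_of f d] is the level l(p,f,d). *)
Record instance (R : realType) := Instance {
  product : finType;
  facility : finType;
  level : product -> facility -> finType;
  dist : product -> finType;
  scenario : forall p : product, dist p -> finType;

  capacity : facility -> R;
  lower : forall (p : product) (f : facility), level p f -> R;
  upper : forall (p : product) (f : facility), level p f -> R;
  cost : product -> facility -> R;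
  full_price : product -> R;
  disc_price : product -> R;
  level_of : forall (p : product) (f : facility), dist p -> level p f;
  prob : forall (p : product) (d : dist p), scenario d -> R;
  yield : forall (p : product) (f : facility) (d : dist p), scenario d -> R;
  demand : forall (p : product) (d : dist p), scenario d -> R;

  capacity_ge0 : forall f, 0 <= capacity f;
  lower_ge0 : forall p f (l : level p f), 0 <= lower l;
  lower_le_upper : forall p f (l : level p f), lower l <= upper l;
  levels_disjoint : forall p f,
    trivIset [set: level p f] (fun l => `[lower l, upper l]%classic);
  zero_level : forall p f, exists l : level p f, lower l = 0 /\ upper l = 0;
  disc_price_ge0 : forall p, 0 <= disc_price p;
  disc_lt_full : forall p, disc_price p < full_price p;
  disc_lt_cost : forall p f, disc_price p < cost p f;
  level_of_bij : forall p (c : forall f, level p f),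
    exists! d : dist p, forall f, level_of f d = c f;
  prob_ge0 : forall p (d : dist p) (s : scenario d), 0 <= prob s;
  prob_sum1 : forall p (d : dist p), \sum_(s : scenario d) prob s = 1;
  yield_ge0 : forall p f (d : dist p) (s : scenario d), 0 <= yield f s;
  demand_ge0 : forall p (d : dist p) (s : scenario d), 0 <= demand s
}.

Section Model.
Context {R : realType} (I : instance R).

Definition quantities := product I -> facility I -> R.
Definition choices := forall (p : product I) (f : facility I), level p f -> bool.

Record solution := Solution {
  sol_x : quantities;
  sol_y : choices;
  sol_mu : product I -> R
}.

Definition first_stage_feasible (x : quantities) (y : choices) : Prop :=
  [/\ forall p f, 0 <= x p f,
      forall f, \sum_(p : product I) x p f <= capacity f,
      forall p f, \sum_(l : level p f) (y p f l)%:R = 1 :> R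
    & forall p f,
        \sum_(l : level p f) lower l * (y p f l)%:R <= x p f /\
        x p f <= \sum_(l : level p f) upper l * (y p f l)%:R].

Lemma dist_inhabited (p : product I) : exists d : dist p, True.
Proof.
have [d _] := level_of_bij (fun f => sval (cid (zero_level p f))).
by exists d.
Qed.

(* [d_p(y)]: the unique [d] with [y p f (level_of f d)] for all [f] when [y] is
   first-stage feasible (see [selected_distP]); arbitrary otherwise. *)
Definition selected_dist (p : product I) (y : choices) : dist p :=
  odflt (sval (cid (dist_inhabited p)))
        [pick d : dist p | [forall f, y p f (level_of f d)]].

Lemma selected_distP (x : quantities) (y : choices) (p : product I)
    (d : dist p) : first_stage_feasible x y ->
  (forall f, y p f (level_of f d)) <-> d = selected_dist p y.
Proof.
move=> [_ _ y1 _].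
have yex f : exists l, y p f l.
  apply/existsP; apply: contraPT (y1 p f) => /existsPn yN.
  rewrite big1 => [/esym/eqP|l _]; first by rewrite oner_eq0.
  by rewrite (negbTE (yN l)).
have yun f l l' : y p f l -> y p f l' -> l = l'.
  move=> yl yl'; apply/eqP; apply: contraPT (y1 p f) => ll'.
  rewrite (bigD1 l) //= (bigD1 l') /= 1?eq_sym // yl yl' => sum1.
  have : 0 <= \sum_(i | (i != l) && (i != l')) (y p f i)%:R :> R.
    exact: sumr_ge0.
  move: sum1; rewrite !mulr1n; set t := \sum_(i | _) _; lra.
have [d0 [d0E d0u]] := level_of_bij (fun f => sval (cid (yex f))).
have y0 f : y p f (level_of f d0) by rewrite d0E; exact: (svalP (cid (yex f))).
have yP e : (forall f, y p f (level_of f e)) -> e = d0.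
  by move=> ye; symmetry; apply: d0u => f; rewrite -d0E; apply: yun.
have -> : selected_dist p y = d0.
  rewrite /selected_dist; case: pickP => [e /forallP /yP //|/(_ d0)].
  by move/forallP.
by split=> [/yP|->].
Qed.

Definition production (x : quantities) (p : product I) (d : dist p)
    (s : scenario d) : R := \sum_(f : facility I) yield f s * x p f.

(* Pairs [(w, o)]: the amounts sold at full and at discounted price. *)
Definition sales (p : product I) (d : dist p) (s : scenario d) (z : R) :
    set (R * R) :=
  [set wo | [/\ wo.1 + wo.2 = z, wo.1 <= demand s, 0 <= wo.1 & 0 <= wo.2]].

(* The supremum is a maximum when [0 <= z]; see [revenue_is_max]. *)
Definition revenue (p : product I) (d : dist p) (s : scenario d) (z : R) : R :=
  sup [set full_price p * wo.1 + disc_price p * wo.2 | wo in sales s z].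

Definition revenue_formula (p : product I) (d : dist p) (s : scenario d)
    (z : R) : R :=
  full_price p * Num.min (demand s) z
  + disc_price p * Num.max (z - demand s) 0.

Lemma revenue_is_max (p : product I) (d : dist p) (s : scenario d) (z : R) :
    0 <= z ->
  let A := [set full_price p * wo.1 + disc_price p * wo.2 | wo in sales s z] in
  [/\ A (revenue s z), ubound A (revenue s z)
    & revenue s z = revenue_formula s z].
Proof.
move=> z0 A; have D0 := demand_ge0 s; have OP := disc_lt_full p.
have Af : A (revenue_formula s z).
  exists (Num.min (demand s) z, Num.max (z - demand s) 0) => //.
  rewrite /sales /= le_min D0 z0 ge_min lexx le_max lexx orbT; split => //.
  by case: (leP (demand s) z) => Dz;
    [rewrite max_l ?subr_ge0 // addrC subrK
    |rewrite max_r ?addr0 // subr_le0 ltW].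
have Au : ubound A (revenue_formula s z).
  move=> _ [[w o] [/= <- wD w0 o0] <-]; rewrite /revenue_formula /=.
  case: (leP (demand s) (w + o)) => Dz; last first.
    by rewrite max_r; [nra|rewrite subr_le0 ltW].
  by rewrite max_l ?subr_ge0 //; nra.
have rE : revenue s z = revenue_formula s z.
  apply/eqP; rewrite eq_le; apply/andP; split.
    by apply: ge_sup => //; exists (revenue_formula s z).
  by apply: ub_le_sup => //; exists (revenue_formula s z).
by rewrite rE.
Qed.

Definition expected_revenue (p : product I) (x : quantities) (y : choices) : R :=
  \sum_(s : scenario (selected_dist p y)) prob s * revenue s (production x s).

(* Upper bound \bar Z_{pds} on [production x s] over all first-stage feasible
   [(x, y)] selecting [d]. *)
Definition max_production (p : product I) (d : dist p) (s : scenario d) : R :=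
  \sum_(f : facility I)
     yield f s * Num.min (capacity f) (upper (level_of f d)).

(* The index type [dist p] is nonempty and the terms are nonnegative, so the
   default value [0] does not affect the maximum. *)
Definition revenue_bound (p : product I) : R :=
  \big[Num.max/0]_(d : dist p)
     \sum_(s : scenario d) prob s * revenue_formula s (max_production s).

Definition up_scenario (p : product I) (d : dist p) (x : quantities) :
    {set scenario d} := [set s | demand s < production x s]%SET.

(* For [d = d_p(y)] the last term vanishes; otherwise it is at least M_p. *)
Definition cut_rhs (p : product I) (d : dist p) (up : {set scenario d})
    (x : quantities) (y : choices) : R :=
  \sum_(s in ~: up) prob s * (full_price p * production x s)
  + \sum_(s in up) prob s * (disc_price p * production x s
                             + (full_price p - disc_price p) * demand s)
  + revenue_bound p
    * (#|facility I|%:R - \sum_(f : facility I) (y p f (level_of f d))%:R).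

(* A cut is identified with the set of its solutions [(x, y, mu)], so that
   equivalent inequalities count once. *)
Definition optimality_cut (p : product I) (xb : quantities) (yb : choices) :
    set solution :=
  [set v | sol_mu v p <=
     cut_rhs (up_scenario (selected_dist p yb) xb) (sol_x v) (sol_y v)].

Definition all_optimality_cuts : set (set solution) :=
  [set c | exists (p : product I) (xb : quantities) (yb : choices),
     first_stage_feasible xb yb /\ c = optimality_cut p xb yb].

Lemma finite_all_optimality_cuts : finite_set all_optimality_cuts.
Proof.
pose T := {p : product I & {d : dist p & {set scenario d}}}.
pose g (t : T) : set solution := [set v | sol_mu v (tag t) <=
  cut_rhs (tagged (tagged t)) (sol_x v) (sol_y v)].
apply: (@sub_finite_set _ _ (g @` [set: T])); last first.
  exact/finite_image/finite_finset.
move=> _ [p [xb [yb [_ ->]]]].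
exists (existT (fun q : product I => {d : dist q & {set scenario d}}) p
  (existT (fun d : dist p => {set scenario d}) (selected_dist p yb)
     (up_scenario (selected_dist p yb) xb))) => //.
Qed.

Definition rmp_objective (v : solution) : R :=
  - (\sum_(p : product I) \sum_(f : facility I) cost p f * sol_x v p f)
  + \sum_(p : product I) sol_mu v p.

Definition rmp_feasible (cuts : set (set solution)) (v : solution) : Prop :=
  [/\ first_stage_feasible (sol_x v) (sol_y v),
      forall p, 0 <= sol_mu v p /\ sol_mu v p <= revenue_bound p
    & forall c, cuts c -> c v].

Definition rmp_optimal (cuts : set (set solution)) (v : solution) : Prop :=
  rmp_feasible cuts v /\
  forall v', rmp_feasible cuts v' -> rmp_objective v' <= rmp_objective v.

End Model.

Arguments all_optimality_cuts {R} I.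

(* Main.v *)
Require Import Defs.
From mathcomp Require Import all_boot all_order all_algebra.
From mathcomp Require Import all_classical all_reals.
From mathcomp Require Import ring lra.

Import Order.TTheory GRing.Theory Num.Theory.
Local Open Scope ring_scope.

(** As a function of the production [z], the revenue of a scenario is the
    minimum of two lines, [P z] and [O z + (P - O) D]: it is concave with its
    kink at [z = D].  A cut picks one of the two lines in each scenario, namely
    the one that attains the minimum at the point that generates the cut.

    Hence the cut generated by [(x, y)] reads [mu p <= Q_p(x, y)] at [(x, y)]
    itself ([cut_rhs_self]).  Conversely, [Q_p(x, y)] satisfies every cut
    ([expected_revenue_le_cut_rhs]): if the distribution [d] of the cut is the
    one selected by [y], the two lines dominate the revenue; otherwise
    [level_of f d] is not chosen at some facility [f], so that the last term of
    the cut is at least [M_p], which bounds [Q_p(x, y)]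
    ([expected_revenue_le_bound]), and the other terms are nonnegative.

    So, with all cuts added, replacing [mu] by [Q(x, y)] in an optimal solution
    keeps it feasible, and does not decrease any component of [mu].  By
    optimality the sum of the components does not increase either, and all of
    them are unchanged. *)

Section Cuts.
Context {R : realType} {I : instance R}.
Implicit Types (p : product I) (x : quantities I) (y : choices I).

Lemma full_price_ge0 p : 0 <= full_price p.
Proof. exact: ltW (le_lt_trans (disc_price_ge0 p) (disc_lt_full p)). Qed.

(** The line picked by a cut in scenario [s]; [b] tells whether [s] belongs to
    the part of the partition where production exceeds demand. *)
Definition revenue_line {p} {d : dist p} (s : scenario d) (b : bool) (z : R) : R :=
  if b then disc_price p * z + (full_price p - disc_price p) * demand s
  else full_price p * z.

Lemma revenue_line_ge0 p (d : dist p) (s : scenario d) b z :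
  0 <= z -> 0 <= revenue_line s b z.
Proof.
move=> z0; have := full_price_ge0 p; have := disc_price_ge0 p.
have := disc_lt_full p; have := demand_ge0 s; rewrite /revenue_line.
by case: b => D0 OP O0 P0; nra.
Qed.

Lemma revenue_formula_le_line p (d : dist p) (s : scenario d) b z :
  revenue_formula s z <= revenue_line s b z.
Proof.
have OP := disc_lt_full p; rewrite /revenue_formula /revenue_line.
case: (leP (demand s) z) => Dz.
  by rewrite max_l ?subr_ge0 //; case: b; nra.
by rewrite max_r ?subr_le0 ?(ltW Dz) //; case: b; nra.
Qed.

Lemma revenue_formulaE p (d : dist p) (s : scenario d) z :
  revenue_formula s z = revenue_line s (demand s < z) z.
Proof.
rewrite /revenue_formula /revenue_line; case: ltP => Dz.
  by rewrite max_l ?subr_ge0 ?(ltW Dz) //; ring.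
by rewrite max_r ?subr_le0 // mulr0 addr0.
Qed.

Lemma revenue_formula_ge0 p (d : dist p) (s : scenario d) z :
  0 <= z -> 0 <= revenue_formula s z.
Proof. by rewrite revenue_formulaE; exact: revenue_line_ge0. Qed.

Lemma revenue_formula_mono p (d : dist p) (s : scenario d) :
  {homo @revenue_formula R I p d s : z z' / z <= z'}.
Proof.
have P0 := full_price_ge0 p; have O0 := disc_price_ge0 p => z z' zz'.
rewrite [leRHS]revenue_formulaE.
(* Both values are compared on the line that is active at [z']; it is
   nondecreasing. *)
apply: le_trans (revenue_formula_le_line _ _ _ (demand s < z') _) _.
by rewrite /revenue_line; case: ifP => _; rewrite ?lerD2r ler_wpM2l.
Qed.

(** Sums over the two parts of the scenario partition are merged into one. *)
Lemma cut_rhsE p (d : dist p) (up : {set scenario d}) x y :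
  cut_rhs up x y =
    \sum_(s : scenario d) prob s * revenue_line s (s \in up) (production x s)
    + revenue_bound p
      * (#|facility I|%:R - \sum_(f : facility I) (y p f (level_of f d))%:R).
Proof.
rewrite /cut_rhs; congr (_ + _).
rewrite [RHS](bigID (fun s => s \in up)) /= [RHS]addrC.
congr (_ + _); apply: eq_big => s; rewrite /revenue_line ?inE //.
- by move/negbTE ->.
- by move=> ->.
Qed.

Lemma revenue_bound_ge0 p : 0 <= revenue_bound p.
Proof.
by rewrite /revenue_bound; elim/big_rec: _ => // d M _ M0; rewrite le_max M0 orbT.
Qed.

Section FirstStage.
Context {x : quantities I} {y : choices I} (feas : first_stage_feasible x y).

Lemma production_ge0 p (d : dist p) (s : scenario d) : 0 <= production x s.
Proof. by case: feas => x0 _ _ _; apply: sumr_ge0 => f _; rewrite mulr_ge0 ?yield_ge0. Qed.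

Lemma expected_revenueE p :
  expected_revenue p x y =
  \sum_(s : scenario (selected_dist p y)) prob s * revenue_formula s (production x s).
Proof.
apply: eq_bigr => s _; congr (_ * _).
by have [_ _ ->] := revenue_is_max s (production_ge0 _ _ s).
Qed.

Lemma expected_revenue_ge0 p : 0 <= expected_revenue p x y.
Proof.
rewrite expected_revenueE; apply: sumr_ge0 => s _.
by rewrite mulr_ge0 ?prob_ge0 ?revenue_formula_ge0 ?production_ge0.
Qed.

Lemma selected_level p f : y p f (level_of f (selected_dist p y)).
Proof. by have [_ /(_ erefl)] := selected_distP (selected_dist p y) feas. Qed.

Lemma quantity_le_upper p f (l : level p f) : y p f l -> x p f <= upper l.
Proof.
case: feas => _ _ /(_ p f) y1 /(_ p f) [_ xU] yl.
suff <- : \sum_(l' : level p f) upper l' * (y p f l')%:R = upper l by [].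
have rest0 : \sum_(l' | l' != l) (y p f l')%:R = 0 :> R.
  by move: y1; rewrite (bigD1 l) //= yl -[RHS]addr0 => /addrI.
rewrite (bigD1 l) //= yl mulr1 big1 ?addr0 // => l' l'l.
by rewrite (psumr_eq0P _ rest0) ?mulr0.
Qed.

Lemma quantity_le_capacity p f : x p f <= capacity f.
Proof.
case: feas => x0 /(_ f) xB _ _; apply: le_trans xB.
by rewrite (bigD1 p) //= lerDl sumr_ge0.
Qed.

Lemma expected_revenue_le_bound p : expected_revenue p x y <= revenue_bound p.
Proof.
rewrite expected_revenueE; set d := selected_dist p y.
apply: (@le_trans _ _
  (\sum_(s : scenario d) prob s * revenue_formula s (max_production s))).
  apply: ler_sum => s _; rewrite ler_wpM2l ?prob_ge0 // revenue_formula_mono //.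
  apply: ler_sum => f _; rewrite ler_wpM2l ?yield_ge0 // le_min.
  by rewrite quantity_le_capacity quantity_le_upper ?selected_level.
exact: le_bigmax.
Qed.

Lemma cut_slack0 p :
  #|facility I|%:R - \sum_(f : facility I) (y p f (level_of f (selected_dist p y)))%:R = 0 :> R.
Proof.
under eq_bigr do rewrite selected_level.
by rewrite sumr_const subrr.
Qed.

(** Holds because a distribution other than the selected one has an unchosen
    level at some facility. *)
Lemma cut_slack_ge1 p (d : dist p) : d <> selected_dist p y ->
  1 <= #|facility I|%:R - \sum_(f : facility I) (y p f (level_of f d))%:R :> R.
Proof.
move=> dN; have /existsP[f yN] : [exists f, ~~ y p f (level_of f d)].
  rewrite -negb_forall; apply/negP => /forallP yd; apply: dN.
  exact/(selected_distP d feas).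
rewrite -sum1_card natr_sum -sumrB (bigD1 f) //= (negbTE yN) subr0 lerDl.
by apply: sumr_ge0 => g _; case: (y p g _); rewrite ?subrr ?subr0.
Qed.

(** A cut is tight at the point that generates it. *)
Lemma cut_rhs_self p :
  cut_rhs (up_scenario (selected_dist p y) x) x y = expected_revenue p x y.
Proof.
rewrite cut_rhsE cut_slack0 mulr0 addr0 expected_revenueE.
by apply: eq_bigr => s _; rewrite inE revenue_formulaE.
Qed.

(** Validity of the cuts: the right-hand side of every cut, whatever its
    scenario partition, dominates the expected revenue. *)
Lemma expected_revenue_le_cut_rhs p (d : dist p) (up : {set scenario d}) :
  expected_revenue p x y <= cut_rhs up x y.
Proof.
rewrite cut_rhsE; have [dE|/eqP dN] := eqVneq d (selected_dist p y).
  subst d; rewrite cut_slack0 mulr0 addr0 expected_revenueE.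
  by apply: ler_sum => s _; rewrite ler_wpM2l ?prob_ge0 ?revenue_formula_le_line.
apply: le_trans (expected_revenue_le_bound p) _.
apply: ler_wpDl; last by rewrite ler_peMr ?revenue_bound_ge0 ?cut_slack_ge1.
by apply: sumr_ge0 => s _; rewrite mulr_ge0 ?prob_ge0 ?revenue_line_ge0 ?production_ge0.
Qed.

Lemma expected_revenue_rmp_feasible :
  rmp_feasible (all_optimality_cuts I)
    (Solution x y (fun p => expected_revenue p x y)).
Proof.
split=> //= [p|_ [p [xb [yb [_ ->]]]]]; last exact: expected_revenue_le_cut_rhs.
by rewrite expected_revenue_ge0 expected_revenue_le_bound.
Qed.

End FirstStage.

Lemma rmp_feasible_le_expected_revenue (v : solution I) p :
  rmp_feasible (all_optimality_cuts I) v ->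
  sol_mu v p <= expected_revenue p (sol_x v) (sol_y v).
Proof.
case=> feas _ cuts; rewrite -cut_rhs_self //.
by apply: (cuts (optimality_cut p (sol_x v) (sol_y v))); exists p, (sol_x v), (sol_y v).
Qed.

End Cuts.

Theorem proposition7 (R : realType) (I : instance R)
    (cuts_k : set (set (solution I))) (v : solution I)
    (all_cuts_added : cuts_k = all_optimality_cuts I)
    (v_optimal : rmp_optimal cuts_k v) :
  forall p : product I, sol_mu v p = expected_revenue p (sol_x v) (sol_y v).
Proof.
rewrite {}all_cuts_added in v_optimal; case: v_optimal => vfeas vopt p.
pose Q q := expected_revenue q (sol_x v) (sol_y v).
have muQ q : sol_mu v q <= Q q by exact: rmp_feasible_le_expected_revenue.
have [feas _ _] := vfeas.
have sumQ : \sum_q Q q <= \sum_q sol_mu v q.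
  by have := vopt _ (expected_revenue_rmp_feasible feas); rewrite lerD2l.
have sum0 : \sum_q (Q q - sol_mu v q) = 0.
  by apply/eqP; rewrite sumrB subr_eq0 eq_le sumQ ler_sum.
apply/esym/eqP; rewrite -subr_eq0; apply/eqP.
by apply: (psumr_eq0P _ sum0) => // q _; rewrite subr_ge0.
Qed.
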